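(* Let $\mathcal Z=\mathbb R^d$ and let $F:\mathcal Z\to\mathcal Z$ be $L$-Lipschitz continuous with respect to $\|\cdot\|_2$ and satisfy the weak MVI property with parameter $0<\rho<\frac1{8L}$: there exists $z^\star\in\mathcal Z$ with $\langle F(z),z-z^\star\rangle\ge-\frac\rho2\|F(z)\|_2^2$ for all $z\in\mathcal Z$. Then, for $2\rho<\eta<\frac1{4L}$ and $m\ge2$, optimistic gradient descent (OGD) with learning rate $\eta$ satisfies $$\sum_{i=1}^{m-1}\|F(z^{(i)})\|_2^2\le\frac{2}{\eta(\eta-2\rho)}\|z^\star-z^{(0)}\|_2^2+\frac{2\rho}{\eta-2\rho}\|F(z^{(m)})\|_2^2,$$ where $z^\star$ is any point that satisfies the weak MVI property. In particular, there is an iterate $z^{(i)}$ such that $$\|F(z^{(i)})\|_2\le\frac1{\sqrt{m-1}}\sqrt{\frac2{\eta(\eta-2\rho)}\|z^\star-z^{(0)}\|_2^2+\frac{2\rho}{\eta-2\rho}\|F(z^{(m)})\|_2^2}.$$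
   Context: OGD in the unconstrained setting, from $\hat z^{(0)}=z^{(0)}\in\mathbb R^d$: for $i\ge1$, $z^{(i)}=\hat z^{(i-1)}-\eta F(z^{(i-1)})$ and $\hat z^{(i)}=\hat z^{(i-1)}-\eta F(z^{(i)})$. *)

(* Defs.v *)
From mathcomp Require Import all_boot all_order all_algebra.
From mathcomp Require Import reals.

Set Implicit Arguments.
Unset Strict Implicit.
Unset Printing Implicit Defensive.

Import Order.TTheory GRing.Theory Num.Theory.

Local Open Scope ring_scope.

Definition dotp (R : realType) (d : nat) (u v : 'rV[R]_d) : R :=
  \sum_(j < d) u 0 j * v 0 j.

(* The norm that mathcomp-analysis puts on matrices is the sup norm, hence
   this separate Euclidean norm. *)
Definition norm2 (R : realType) (d : nat) (u : 'rV[R]_d) : R :=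
  Num.sqrt (dotp u u).

(* For the same reason the library's [lipschitz] predicates, which are stated
   for the canonical norm, are not used here. *)
Definition lipschitz2 (R : realType) (d : nat) (L : R)
    (F : 'rV[R]_d -> 'rV[R]_d) : Prop :=
  forall x y : 'rV[R]_d, norm2 (F x - F y) <= L * norm2 (x - y).

Definition weak_MVI_point (R : realType) (d : nat) (rho : R)
    (F : 'rV[R]_d -> 'rV[R]_d) (zstar : 'rV[R]_d) : Prop :=
  forall z : 'rV[R]_d,
    dotp (F z) (z - zstar) >= - (rho / 2) * norm2 (F z) ^+ 2.

Definition weak_MVI (R : realType) (d : nat) (rho : R)
    (F : 'rV[R]_d -> 'rV[R]_d) : Prop :=
  exists zstar : 'rV[R]_d, weak_MVI_point rho F zstar.

(* [z i] is the iterate z^(i) and [zhat i] the secondary iterate \hat z^(i);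
   the starting point z^(0) is arbitrary.  The recursion is indexed by i.+1,
   i.e. it holds for every index >= 1. *)
Definition is_OGD (R : realType) (d : nat) (eta : R)
    (F : 'rV[R]_d -> 'rV[R]_d) (z zhat : nat -> 'rV[R]_d) : Prop :=
  zhat 0%N = z 0%N /\
  forall i : nat,
    z i.+1 = zhat i - eta *: F (z i) /\
    zhat i.+1 = zhat i - eta *: F (z i.+1).

(* Main.v *)
(* The potential [V i = |zhat i - zstar|^2 + |zhat i - z i|^2] satisfies
     [V i.+1 + eta^2 / 2 * |F (z i)|^2 <= V i + eta * rho * |F (z i.+1)|^2]:
   expand [|zhat i.+1 - zstar|^2] with [zhat i = z i.+1 + eta F (z i)], use the
   weak MVI at [z i.+1], and absorb [2 eta^2 |F (z i.+1) - F (z i)|^2] through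
   the Lipschitz bound, since [16 L^2 eta^2 <= 1] and
   [z i.+1 - z i = (zhat i - z i) - eta F (z i)].  Telescoping from
   [V 0 = |z 0 - zstar|^2] gives the bound on the sum, and the smallest term is
   at most the average. *)

Require Import Defs.
From mathcomp Require Import all_boot all_order all_algebra.
From mathcomp Require Import reals.
From mathcomp Require Import ring lra.

Set Implicit Arguments.
Unset Strict Implicit.
Unset Printing Implicit Defensive.

Import Order.TTheory GRing.Theory Num.Theory.

Local Open Scope ring_scope.

Lemma dotpC (R : realType) (d : nat) (u v : 'rV[R]_d) : dotp u v = dotp v u.
Proof. by apply: eq_bigr => j _; rewrite mulrC. Qed.

Lemma dotpDl (R : realType) (d : nat) (u v w : 'rV[R]_d) :
  dotp (u + v) w = dotp u w + dotp v w.
Proof. by rewrite -big_split; apply: eq_bigr => j _; rewrite mxE mulrDl. Qed.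

Lemma dotpZl (R : realType) (d : nat) (a : R) (u v : 'rV[R]_d) :
  dotp (a *: u) v = a * dotp u v.
Proof. by rewrite /dotp mulr_sumr; apply: eq_bigr => j _; rewrite mxE mulrA. Qed.

Lemma dotpBl (R : realType) (d : nat) (u v w : 'rV[R]_d) :
  dotp (u - v) w = dotp u w - dotp v w.
Proof. by rewrite dotpDl -scaleN1r dotpZl mulN1r. Qed.

Lemma dotpBr (R : realType) (d : nat) (u v w : 'rV[R]_d) :
  dotp w (u - v) = dotp w u - dotp w v.
Proof. by rewrite dotpC dotpBl !(dotpC w). Qed.

Lemma dotpZr (R : realType) (d : nat) (a : R) (u v : 'rV[R]_d) :
  dotp u (a *: v) = a * dotp u v.
Proof. by rewrite dotpC dotpZl dotpC. Qed.

Lemma dotp_ge0 (R : realType) (d : nat) (u : 'rV[R]_d) : 0 <= dotp u u.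
Proof. by apply: sumr_ge0 => j _; rewrite -expr2 sqr_ge0. Qed.

Lemma norm2_ge0 (R : realType) (d : nat) (u : 'rV[R]_d) : 0 <= norm2 u.
Proof. exact: sqrtr_ge0. Qed.

Lemma norm2_sqr (R : realType) (d : nat) (u : 'rV[R]_d) :
  norm2 u ^+ 2 = dotp u u.
Proof. by rewrite sqr_sqrtr // dotp_ge0. Qed.

Lemma norm2_sub_sym (R : realType) (d : nat) (u v : 'rV[R]_d) :
  norm2 (u - v) = norm2 (v - u).
Proof. by congr Num.sqrt; rewrite !dotpBl !dotpBr; ring. Qed.

(* One OGD step, with [u = zhat i - zstar], [w = zhat i - z i], [f = F (z i)]
   and [g = F (z i.+1)]. *)
Lemma potential_step (R : realType) (d : nat) (L rho eta : R)
    (u w f g : 'rV[R]_d) :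
  0 <= eta -> 16 * (L * eta) ^+ 2 <= 1 ->
  - (rho / 2) * dotp g g <= dotp g (u - eta *: f) ->
  dotp (g - f) (g - f) <= L ^+ 2 * dotp (w - eta *: f) (w - eta *: f) ->
  dotp (u - eta *: g) (u - eta *: g)
    + dotp (eta *: (f - g)) (eta *: (f - g)) + eta ^+ 2 / 2 * dotp f f
  <= dotp u u + dotp w w + eta * rho * dotp g g.
Proof.
move=> eta0 hL hmvi hlip.
(* Nonnegativity of |w + eta f|^2 amounts to |w - eta f|^2 <= 2 |w|^2 + 2 eta^2 |f|^2. The double
   negation lets [dotpBl] and [dotpBr] expand it. *)
have hsum := dotp_ge0 (w - (- eta) *: f).
have hf := mulr_ge0 (sqr_ge0 eta) (dotp_ge0 f).
have hw := dotp_ge0 w.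
have {}hlip : eta ^+ 2 * dotp (g - f) (g - f)
    <= dotp (w - eta *: f) (w - eta *: f) / 16.
  have h1 := ler_wpM2l (sqr_ge0 eta) hlip.
  have h2 := ler_wpM2r (dotp_ge0 (w - eta *: f)) hL.
  by rewrite exprMn in h2; lra.
have {}hmvi := ler_wpM2l eta0 hmvi.
move: hmvi hlip hsum hf hw.
rewrite !(dotpBl, dotpBr, dotpZl, dotpZr).
(* The goal is the sum of [hmvi], [hlip], [hsum], [hw] and [hf] with weights 2, 2, 1/8, 3/4 and
   1/4. *)
by rewrite (dotpC f w) (dotpC g u) (dotpC g f); lra.
Qed.

(** The two sums are shifted by one index because a step gains |F (z i)|^2 but applies the weak MVI
    at [z i.+1]. They overlap on 1 <= i < m. *)
Lemma OGD_potential_sum (R : realType) (d : nat) (L rho eta : R)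
    (F : 'rV[R]_d -> 'rV[R]_d) (z zhat : nat -> 'rV[R]_d) (zstar : 'rV[R]_d)
    (m : nat) :
  0 <= L -> lipschitz2 L F -> 0 <= eta -> 16 * (L * eta) ^+ 2 <= 1 ->
  is_OGD eta F z zhat -> weak_MVI_point rho F zstar ->
  norm2 (zhat m - zstar) ^+ 2 + norm2 (zhat m - z m) ^+ 2
    + eta ^+ 2 / 2 * (\sum_(0 <= i < m) norm2 (F (z i)) ^+ 2)
  <= norm2 (zstar - z 0%N) ^+ 2
     + eta * rho * (\sum_(1 <= i < m.+1) norm2 (F (z i)) ^+ 2).
Proof.
move=> L0 hlip eta0 hL [z0 hz] hmvi; elim: m => [|m IH].
  rewrite z0 subrr !big_geq // !mulr0 !addr0 norm2_sub_sym.
  by rewrite (norm2_sqr 0) [dotp 0 _]big1 ?addr0 // => j _; rewrite mxE mul0r.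
have [hz1 hz2] := hz m.
rewrite big_nat_recr //= (big_nat_recr m.+1) //=.
have stepP : norm2 (zhat m.+1 - zstar) ^+ 2 + norm2 (zhat m.+1 - z m.+1) ^+ 2
    + eta ^+ 2 / 2 * norm2 (F (z m)) ^+ 2
    <= norm2 (zhat m - zstar) ^+ 2 + norm2 (zhat m - z m) ^+ 2
       + eta * rho * norm2 (F (z m.+1)) ^+ 2.
  have -> : zhat m.+1 - zstar = (zhat m - zstar) - eta *: F (z m.+1).
    by rewrite hz2 addrAC.
  (* Both updates start from [zhat m], which cancels. *)
  have -> : zhat m.+1 - z m.+1 = eta *: (F (z m) - F (z m.+1)).
    by rewrite hz2 {2}hz1 scalerBr opprB addrC addrA subrK.
  rewrite !norm2_sqr; apply: (potential_step (L := L)) => //.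
    by have := hmvi (z m.+1); rewrite norm2_sqr {4}hz1 addrAC.
  have -> : zhat m - z m - eta *: F (z m) = z m.+1 - z m by rewrite hz1 addrAC.
  by rewrite -!norm2_sqr -exprMn lerXn2r ?nnegrE ?mulr_ge0 ?norm2_ge0.
lra.
Qed.

Lemma exists_le_average (R : realType) (a : nat -> R) (n : nat) (B : R) :
  (0 < n)%N -> \sum_(1 <= i < n.+1) a i <= B ->
  exists i : nat, (1 <= i <= n)%N /\ a i <= B / n%:R.
Proof.
move=> n0 hB; have n0R : 0 < n%:R :> R by rewrite ltr0n.
have [/hasP [i]|/hasPn hn] := boolP (has (fun i => a i <= B / n%:R) (index_iota 1 n.+1)).
  by rewrite mem_index_iota ltnS => ? ?; exists i.
suff : B < \sum_(1 <= i < n.+1) a i by rewrite ltNge hB.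
have -> : B = \sum_(1 <= i < n.+1) B / n%:R.
  by rewrite sumr_const_nat subn1 -[LHS](divfK (lt0r_neq0 n0R)) mulr_natr.
(* The strict inequality survives summation because [n0] makes the range nonempty. *)
apply: ltr_sum_nat => // i hi.
by rewrite ltNge; apply: hn; rewrite mem_index_iota.
Qed.

Theorem theoremC20 (R : realType) (d : nat) (L rho eta : R)
    (F : 'rV[R]_d -> 'rV[R]_d) (z zhat : nat -> 'rV[R]_d) (m : nat)
    (L_gt0 : 0 < L) (F_lip : lipschitz2 L F)
    (rho_gt0 : 0 < rho) (rho_lt : rho < 1 / (8 * L))
    (F_wMVI : weak_MVI rho F)
    (eta_gt : 2 * rho < eta) (eta_lt : eta < 1 / (4 * L))
    (m_ge2 : (2 <= m)%N)
    (z_OGD : is_OGD eta F z zhat) :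
  forall zstar : 'rV[R]_d, weak_MVI_point rho F zstar ->
    \sum_(1 <= i < m) norm2 (F (z i)) ^+ 2
      <= 2 / (eta * (eta - 2 * rho)) * norm2 (zstar - z 0%N) ^+ 2
         + 2 * rho / (eta - 2 * rho) * norm2 (F (z m)) ^+ 2
    /\ exists i : nat, (1 <= i <= m - 1)%N /\
      norm2 (F (z i))
        <= 1 / Num.sqrt (m - 1)%:R
           * Num.sqrt (2 / (eta * (eta - 2 * rho)) * norm2 (zstar - z 0%N) ^+ 2
                       + 2 * rho / (eta - 2 * rho) * norm2 (F (z m)) ^+ 2).
Proof.
move=> zstar hmvi.
set B := (X in _ <= X /\ _).
have eta0 : 0 < eta by lra.
have ge0 : 0 < eta - 2 * rho by lra.
have Leta : 4 * (L * eta) < 1.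
  by move: eta_lt; rewrite ltr_pdivlMr; [lra | lra].
have hL : 16 * (L * eta) ^+ 2 <= 1.
  have : 0 < L * eta by rewrite mulr_gt0.
  nra.
have hsum : \sum_(1 <= i < m) norm2 (F (z i)) ^+ 2 <= B.
  have := OGD_potential_sum m (ltW L_gt0) F_lip (ltW eta0) hL z_OGD hmvi.
  (* Splitting off i = m on the right and i = 0 on the left leaves the same sum S on both sides,
     with net coefficient eta^2 / 2 - eta rho = eta (eta - 2 rho) / 2. The i = 0 term and the final
     potential are nonnegative and are dropped. *)
  rewrite (big_nat_recr m) ?(ltnW m_ge2) //= (big_ltn (ltnW m_ge2)).
  have := sqr_ge0 (norm2 (zhat m - zstar)); have := sqr_ge0 (norm2 (zhat m - z m)).
  have := mulr_ge0 (sqr_ge0 eta) (sqr_ge0 (norm2 (F (z 0%N)))).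
  rewrite /B; set S := \sum_(1 <= i < m) _ => h1 h2 h3 h4.
  have -> : 2 / (eta * (eta - 2 * rho)) * norm2 (zstar - z 0%N) ^+ 2
      + 2 * rho / (eta - 2 * rho) * norm2 (F (z m)) ^+ 2
    = (2 * norm2 (zstar - z 0%N) ^+ 2 + 2 * (eta * rho) * norm2 (F (z m)) ^+ 2)
      / (eta * (eta - 2 * rho)).
    by field; rewrite !lt0r_neq0.
  by rewrite ler_pdivlMr ?mulr_gt0 //; lra.
split=> //.
have m1 : (0 < m - 1)%N by rewrite subn_gt0.
have hm : m = (m - 1).+1 by rewrite subn1 prednK // ltnW.
rewrite {1}hm in hsum.
have [i [hi hle]] := exists_le_average m1 hsum.
exists i; split=> //.
have n0 : 0 <= (m - 1)%:R^-1 :> R by rewrite invr_ge0 ler0n.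
(* Merging the right-hand side under one root reduces the claim to the averaged bound on the squared
   norm. *)
rewrite div1r -sqrtrV ?ler0n // -sqrtrM // /norm2 ler_wsqrtr //.
by rewrite -norm2_sqr mulrC.
Qed.
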